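(* Let $T$ be a finite tree and let $T'=KC(T,x,y)$ be a KC-transform of $T$. Then for every integer $\ell\ge 1$, the number of walks of length $\ell$ in $T'$ is at least the number of walks of length $\ell$ in $T$.
   Context: KC-transformation: let $x,y$ be two vertices of a tree $T$ such that every interior vertex of the unique $x$–$y$ path $P$ in $T$ has degree two in $T$, and let $z$ be the neighbour of $y$ on $P$. Writing $\Gamma(v)$ for the set of neighbours of $v$, the KC-transform $KC(T,x,y)$ is the tree obtained from $T$ by deleting all edges between $y$ and $\Gamma(y)\setminus\{z\}$ and adding the edges between $x$ and $\Gamma(y)\setminus\{z\}$ instead. A walk of length $\ell$ is a sequence of vertices $v_0,v_1,\dots,v_\ell$ with $v_{i-1}v_i$ an edge for each $i$ (not necessarily closed). *)

(* Defs.v *)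
From mathcomp Require Import all_boot.
Set Implicit Arguments. Unset Strict Implicit. Unset Printing Implicit Defensive.

Definition simple_graph (V : finType) (e : rel V) : Prop :=
  symmetric e /\ irreflexive e.

Definition is_tree (V : finType) (e : rel V) : Prop :=
  [/\ simple_graph e,
      (forall u v : V, connect e u v) &
      (forall s : seq V, uniq s -> 3 <= size s -> ~~ cycle e s)].

Definition nbhd (V : finType) (e : rel V) (v : V) : {set V} := [set w | e v w].
Definition deg (V : finType) (e : rel V) (v : V) : nat := #|nbhd e v|.

Definition KC (V : finType) (e : rel V) (x y z : V) : rel V :=
  fun u v =>
    let N := nbhd e y :\ z in
    (e u v && ~~ (((u == y) && (v \in N)) || ((v == y) && (u \in N))))
    || (((u == x) && (v \in N)) || ((v == x) && (u \in N))).

Definition walkb (V : finType) (e : rel V) (s : seq V) : bool :=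
  if s is v :: s' then path e v s' else false.

Definition num_walks (V : finType) (e : rel V) (l : nat) : nat :=
  #|[set t : (l.+1).-tuple V | walkb e t]|.

(* Main.v *)
(* Let W(v) and W'(v) be the numbers of walks of length l starting at v in T and
   in T', let p_0 = x, ..., p_k = y be the path, A and B the sets of neighbours of
   x and y outside the path, and D(i) = W'(p_i) - W(p_i).  When A and B are
   nonempty, one shows by simultaneous induction on l that
     (1) D(i) + D(j) >= 0 whenever i + j <= k,
     (2) sum_A (W' - W) + sum_B W' + D(j) >= 0 for 1 <= j <= k,
     (3) W' >= W outside the path,
   together with the mirror images of (1) and (2), in which W(p_i) is replaced by
   W(p_(k-i)) and A, B are exchanged.  Inequality (2) plays the role of (1) with
   i = -1; the case j = k of its induction step also needs that W is
   nondecreasing in l.  Summing (1) over the pairs (i, k - i) and adding (3) gives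
   the result.  If B is empty then T' = T, and if A is empty then T' is isomorphic
   to T by reversing the path. *)
Require Import Defs.
From mathcomp Require Import all_boot.
From mathcomp Require Import zify.

Set Implicit Arguments. Unset Strict Implicit. Unset Printing Implicit Defensive.

(** * Walk counts by starting vertex *)

Fixpoint walks_from (V : finType) (e : rel V) (l : nat) (v : V) : nat :=
  if l is m.+1 then \sum_(u | e v u) walks_from e m u else 1.

Lemma sum_tupleS (V : finType) (n : nat) (F : n.+1.-tuple V -> nat) :
  \sum_t F t = \sum_v \sum_(t : n.-tuple V) F [tuple of v :: t].
Proof.
rewrite pair_big /= (reindex (fun u : V * n.-tuple V => [tuple of u.1 :: u.2])) //=.
exists (fun t : n.+1.-tuple V => (thead t, [tuple of behead t])) => [[v t] _|t _] /=.
  by rewrite theadE; congr (_, _); apply/val_inj.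
by rewrite [RHS]tuple_eta.
Qed.

Lemma walks_fromE (V : finType) (e : rel V) (l : nat) (v : V) :
  walks_from e l v = \sum_(t : l.-tuple V) path e v t.
Proof.
elim: l v => [|l IHl] v /=.
  rewrite (eq_bigr (fun=> 1)) => [|t _]; last by rewrite tuple0.
  by rewrite sum_nat_const card_tuple expn0.
rewrite sum_tupleS big_mkcond; apply: eq_bigr => u _ /=.
rewrite IHl; case: (e v u) => //=.
by rewrite big1.
Qed.

Lemma num_walksE (V : finType) (e : rel V) (l : nat) :
  num_walks e l = \sum_v walks_from e l v.
Proof.
rewrite /num_walks -sum1dep_card big_mkcond sum_tupleS.
apply: eq_bigr => v _; rewrite walks_fromE; apply: eq_bigr => t _ /=.
by case: path.
Qed.

Lemma eq_walks_from (V : finType) (e e' : rel V) :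
  e =2 e' -> forall l, walks_from e l =1 walks_from e' l.
Proof.
move=> ee'; elim=> //= l IHl v.
by apply: eq_big => [u|u _]; rewrite ?ee' ?IHl.
Qed.

(** When no vertex is isolated, every walk extends by one more edge; the case j = k of inequality
    (2) rests on this. *)
Lemma leq_walks_from (V : finType) (e : rel V) (l : nat) (v : V) :
  (forall u, exists w, e u w) -> walks_from e l v <= walks_from e l.+1 v.
Proof.
move=> e_total; elim: l v => [|l IHl] v; last exact: leq_sum.
by have [w evw] := e_total v; rewrite /= (bigD1 w).
Qed.

(** * Neighbour sums in a graph with an attached path *)

Lemma sum_seq_split (V : finType) (x0 : V) (s : seq V) (F : V -> nat) :
  uniq s ->
  \sum_v F v = \sum_(i < size s) F (nth x0 s i) + \sum_(v | v \notin s) F v.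
Proof.
by move=> Us; rewrite (bigID (mem s)) /= -big_uniq //= (big_nth x0) big_mkord.
Qed.

(* The vertices of [s], in order, form an induced path of [g], and the other
   vertices are joined to [s] only through its first vertex (those in [a]) and
   its last vertex (those in [b]). *)
Definition attached_path (V : finType) (g : rel V) (x0 : V) (s : seq V)
    (a b : pred V) : Prop :=
  [/\ uniq s,
      forall i j, i < size s -> j < size s ->
        g (nth x0 s i) (nth x0 s j) = (j == i.+1) || (i == j.+1),
      symmetric g &
      forall v i, v \notin s -> i < size s ->
        g v (nth x0 s i) = (i == 0) && a v || (i.+1 == size s) && b v].

Definition sum_off (V : finType) (s : seq V) (a : pred V) (F : V -> nat) : nat :=
  \sum_(v | (v \notin s) && a v) F v.

Section AttachedPath.

Variables (V : finType) (g : rel V) (x0 : V) (s : seq V) (a b : pred V).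
Hypothesis gP : attached_path g x0 s a b.

Local Notation p := (nth x0 s).

Hypothesis s2 : 1 < size s.

Lemma attached_path_sum (F : V -> nat) (v : V) :
  \sum_(u | g v u) F u =
    \sum_(j < size s | g v (p j)) F (p j) + sum_off s (g v) F.
Proof.
case: gP => Us _ _ _.
rewrite big_mkcond (sum_seq_split x0 _ Us) -big_mkcond -big_mkcondr /=.
by congr (_ + _); apply: eq_bigl => u; rewrite andbC.
Qed.

(** At an end of the path, the whole attached set stands in for the missing path neighbour. *)
Lemma sum_neighbors_on (F : V -> nat) (i : nat) : i < size s ->
  \sum_(u | g (p i) u) F u =
    (if i is j.+1 then F (p j) else sum_off s a F) +
    (if i.+1 < size s then F (p i.+1) else sum_off s b F).
Proof.
case: gP => Us gpp gsym gop lt_i; rewrite attached_path_sum.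
have -> : \sum_(j < size s | g (p i) (p j)) F (p j) =
    (if i is j.+1 then F (p j) else 0) + (if i.+1 < size s then F (p i.+1) else 0).
  rewrite -(big_ord1_eq addn (fun j => F (p j)) i.+1).
  have -> : (if i is j.+1 then F (p j) else 0) =
      \sum_(j < size s | i == j.+1) F (p j).
    case: i lt_i => [|i] lt_i; first by rewrite big_pred0.
    under eq_bigl do rewrite eqSS eq_sym.
    by rewrite (big_ord1_eq addn (fun j => F (p j))) ltnW.
  rewrite big_mkcond [X in _ = X + _]big_mkcond [X in _ = _ + X]big_mkcond.
  rewrite -big_split /=; apply: eq_bigr => j _; rewrite gpp //.
  by do 2 case: eqP => //=; lia.
have -> : sum_off s (g (p i)) F =
    (if i is j.+1 then 0 else sum_off s a F) + (if i.+1 < size s then 0 else sum_off s b F).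
  rewrite /sum_off; case: i lt_i => [|i] lt_i.
    rewrite s2 addn0; apply: eq_bigl => u; case: (boolP (u \in s)) => //= uNs.
    rewrite gsym gop //=; lia.
  case: ltnP => lt_i2; [rewrite big_pred0 //|apply: eq_bigl] => u;
    case: (boolP (u \in s)) => //= uNs; rewrite gsym gop //=; lia.
by case: i lt_i => [|i] lt_i; case: ltnP; lia.
Qed.

Lemma sum_neighbors_off (F : V -> nat) (v : V) : v \notin s ->
  \sum_(u | g v u) F u =
    a v * F (p 0) + b v * F (p (size s).-1) + sum_off s (g v) F.
Proof.
case: gP => Us gpp gsym gop vNs; rewrite attached_path_sum; congr (_ + _).
rewrite big_mkcond /=.
rewrite (eq_bigr (fun j : 'I_(size s) => (if j == 0 :> nat then a v * F (p 0) else 0)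
    + (if j == (size s).-1 :> nat then b v * F (p (size s).-1) else 0))).
  rewrite big_split -!big_mkcond /=.
  rewrite (big_ord1_eq addn (fun=> _)) (big_ord1_eq addn (fun=> _)).
  by rewrite ltnW // prednK ?leqnn // ltnW.
move=> j _; rewrite gop //; case: j => j lt_j /=.
have -> : (j.+1 == size s) = (j == (size s).-1) by lia.
case: eqP => [->|_]; case: eqP => //=; try lia; case: (a v); case: (b v) => //=; try lia.
all: move=> ->; rewrite ?mul1n ?mul0n; lia.
Qed.

End AttachedPath.

(** * The inequalities along the path, as pure arithmetic *)

(* Recurrence from length l ([w]) to length l + 1 ([wn]) for the walk counts at
   p_0, ..., p_k; S0 and Sk are the contributions of the neighbours of p_0 and p_k
   off the path. *)
Definition path_step (k : nat) (w wn : nat -> nat) (S0 Sk : nat) : Prop :=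
  [/\ wn 0 = S0 + w 1,
      forall i, 0 < i -> i < k -> wn i = w i.-1 + w i.+1 &
      wn k = w k.-1 + Sk].

(** Reversing the path exchanges its two ends, so that one induction step also serves the mirror
    inequalities. *)
Lemma path_step_rev (k : nat) (w wn : nat -> nat) (S0 Sk : nat) :
  0 < k -> path_step k w wn S0 Sk ->
  path_step k (fun i => w (k - i)) (fun i => wn (k - i)) Sk S0.
Proof.
move=> k0 [h0 hi hk]; split=> [|i i0 ik|].
- by rewrite subn0 hk subn1 addnC.
- rewrite hi; [|lia|lia]; rewrite addnC.
  by congr (w _ + w _); lia.
- rewrite subnn h0 addnC; congr (w _ + _); lia.
Qed.

(* Inequalities (1) and (2), written without subtraction. *)
Definition dominates (k : nat) (w w' : nat -> nat) (SA SA' SB' : nat) : Prop :=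
  (forall i j, i + j <= k -> w i + w j <= w' i + w' j) /\
  (forall j, 0 < j -> j <= k -> SA + w j <= SA' + SB' + w' j).

(** [T'] has both sets at [p_0], hence [SA' + SB'] at one end and 0 at the other. The suffix [n]
    marks length l + 1, [dA] and [dB] are |A| and |B|, and [SA2], [SA2'], [SB2'] count the walks
    that continue off the path. *)
Lemma dominates_step (k : nat) (w wn w' wn' : nat -> nat)
    (SA SB SA' SB' SAn SAn' SBn' dA dB SA2 SA2' SB2' : nat) :
  0 < k -> 0 < dA -> 0 < dB ->
  path_step k w wn SA SB -> path_step k w' wn' (SA' + SB') 0 ->
  SA <= SA' -> SB <= SB' -> SB <= SBn' -> SA2 <= SA2' ->
  SAn = dA * w 0 + SA2 -> SAn' = dA * w' 0 + SA2' -> SBn' = dB * w' 0 + SB2' ->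
  dominates k w w' SA SA' SB' -> dominates k wn wn' SAn SAn' SBn'.
Proof.
move=> k0 dA0 dB0 [w0 wi wk] [w'0 w'i w'k] leA leB leBn leA2 eAn eA'n eB'n [Hp Ht].
have H00 := Hp 0 0 isT.
(* As D(0) >= 0 and [dA] >= 1, [dA] copies of D(0) are worth at least one. *)
have leA1 : dA * w 0 + w' 0 <= dA * w' 0 + w 0.
  by case: dA dA0 {eAn eA'n} => // d _; rewrite !mulSn; have : d * w 0 <= d * w' 0
    by [rewrite leq_mul2l; lia]; lia.
split.
  move=> i j; wlog le_ij : i j / i <= j => [hw|] hij.
    by case: (leqP i j) => h; [|rewrite addnC [leqRHS]addnC]; apply: hw; lia.
  have [jk|jk] := ltnP j k.
    have [i0|i0] := posnP i; last first.
      (* The pairs (i - 1, j + 1) and (i + 1, j - 1) keep the index sum, so (1) applies to both. *)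
      rewrite !wi ?w'i; try lia.
      have := Hp i.-1 j.+1; have := Hp i.+1 j.-1; lia.
    have [j0|j0] := posnP j.
      by rewrite i0 j0 w0 w'0; have := Ht 1 isT k0; lia.
    rewrite i0 w0 w'0 wi // w'i //.
    have := Hp 1 j.-1; have := Ht j.+1; lia.
  have -> : i = 0 by lia.
  have -> : j = k by lia.
  (* [SB] is lost at [p_k], but [SB'] is gained at [p_0]. *)
  rewrite w0 w'0 wk w'k; have := Hp 1 k.-1; lia.
move=> j j0 jk; have [ltjk|] := ltnP j k; last first.
  move=> kj; have -> : j = k by lia.
  (* The loss [SB] belongs to length l and the gain [SBn'] to length l + 1; [leBn] compares them. *)
  rewrite wk w'k; have := Hp 0 k.-1; lia.
(* B contributes at least [w' 0] >= D(0), which acts as a second copy of D(0): one is paired with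
   D(j - 1), the other with D(j + 1). *)
have leB1 : w' 0 <= dB * w' 0 by rewrite leq_pmull.
rewrite wi // w'i //; have := Hp 0 j.-1; have := Hp 0 j.+1; lia.
Qed.

(** * Walk counts as solutions of the recurrence *)

Lemma eq_sum_off (V : finType) (s : seq V) (a : pred V) (F G : V -> nat) :
  (forall v, v \notin s -> a v -> F v = G v) -> sum_off s a F = sum_off s a G.
Proof. by move=> FG; apply: eq_bigr => v /andP[]; exact: FG. Qed.

Lemma leq_sum_off (V : finType) (s : seq V) (a : pred V) (F G : V -> nat) :
  (forall v, v \notin s -> F v <= G v) -> sum_off s a F <= sum_off s a G.
Proof. by move=> FG; apply: leq_sum => v /andP[vNs _]; exact: FG. Qed.

Lemma sum_off0 (V : finType) (s : seq V) (a : pred V) (F : V -> nat) :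
  (forall v, v \notin s -> ~~ a v) -> sum_off s a F = 0.
Proof. by move=> a0; apply: big_pred0 => v; apply/negP => /andP[/a0/negP]. Qed.

Lemma sum_off_gt0 (V : finType) (s : seq V) (a : pred V) (v : V) :
  v \notin s -> a v -> 0 < sum_off s a (fun=> 1).
Proof. by move=> vNs av; rewrite /sum_off (bigD1 v) ?vNs. Qed.

Lemma attached_path_step (V : finType) (g : rel V) (x0 : V) (s : seq V)
    (a b : pred V) (l : nat) :
  attached_path g x0 s a b -> 1 < size s ->
  path_step (size s).-1 (fun i => walks_from g l (nth x0 s i))
    (fun i => walks_from g l.+1 (nth x0 s i))
    (sum_off s a (walks_from g l)) (sum_off s b (walks_from g l)).
Proof.
move=> gP s2; split=> [|i i0 ik|] /=; rewrite (sum_neighbors_on gP) //; try lia.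
- by rewrite s2.
- by case: i i0 ik => // i _ ik; rewrite ifT //; lia.
- rewrite prednK ?ltnn; last lia.
  by have -> : (size s).-1 = (size s).-2.+1 by lia.
Qed.

(** Each vertex of [c] off the path has exactly one neighbour on it, the last vertex if [t] holds
    and the first otherwise. *)
Lemma sum_off_walks_from (V : finType) (g : rel V) (x0 : V) (s : seq V)
    (a b c : pred V) (l : nat) (t : bool) :
  attached_path g x0 s a b -> 1 < size s ->
  (forall v, v \notin s -> c v -> a v = ~~ t /\ b v = t) ->
  sum_off s c (walks_from g l.+1) =
    sum_off s c (fun=> 1) * walks_from g l (nth x0 s (if t then (size s).-1 else 0)) +
    sum_off s c (fun v => sum_off s (g v) (walks_from g l)).
Proof.
move=> gP s2 cP; rewrite big_distrl -big_split /=.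
apply: eq_sum_off => v vNs cv; rewrite (sum_neighbors_off gP) //.
by have [-> ->] := cP v vNs cv; case: t {cP}; rewrite /= mul1n mul0n ?addn0.
Qed.

(** * Moving both attached sets to the first end of the path *)

Section Slide.

Variables (V : finType) (g g' : rel V) (x0 : V) (s : seq V) (a b : pred V).
Hypotheses (gP : attached_path g x0 s a b)
  (g'P : attached_path g' x0 s (predU a b) pred0)
  (s2 : 1 < size s)
  (gg' : forall u v, u \notin s -> v \notin s -> g u v = g' u v)
  (abP : forall v, v \notin s -> ~~ (a v && b v)).

Local Notation p := (nth x0 s).
Local Notation k := (size s).-1.
Local Notation W := (walks_from g).
Local Notation W' := (walks_from g').

Let k0 : 0 < k. Proof. by lia. Qed.

Let sum_off_predU F : sum_off s (predU a b) F = sum_off s a F + sum_off s b F.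
Proof.
rewrite /sum_off (bigID a) /=; congr (_ + _); apply: eq_bigl => v /=.
  by case: (a v); rewrite ?andbF ?andbT.
case: (boolP (v \in s)) => //= vNs; move: (abP vNs).
by case: (a v); case: (b v).
Qed.

(** Only [b] is attached, so reversing the path carries [g] to [g']; the induction compares counts
    directly instead of building the isomorphism. *)
Lemma slide_walks_iso (l : nat) : (forall v, v \notin s -> ~~ a v) ->
  \sum_v W l v = \sum_v W' l v.
Proof.
move=> a0.
have [Hp Ho] : (forall i, i <= k -> W' l (p i) = W l (p (k - i))) /\
    (forall v, v \notin s -> W' l v = W l v).
  elim: l => [//|l [Hp Ho]]; split=> [i ik|v vNs].
    have [w0 wi wk] := path_step_rev k0 (attached_path_step l gP s2).
    have [w'0 w'i w'k] := attached_path_step l g'P s2.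
    have [->|i0] := posnP i.
      rewrite w'0 w0 sum_off_predU sum_off0 // Hp // add0n; congr (_ + _).
      by apply: eq_sum_off => v vNs _; exact: Ho.
    have [lt_ik|] := ltnP i k; last first.
      move=> ki; have -> : i = k by lia.
      by rewrite w'k wk Hp ?(sum_off0 _ a0) ?sum_off0 //; lia.
    by rewrite w'i // wi // !Hp //; lia.
  rewrite /= (sum_neighbors_off gP) // (sum_neighbors_off g'P) //=.
  rewrite (negPf (a0 v vNs)) /= mul0n addn0 add0n Hp // subn0; congr (_ + _).
  rewrite /sum_off; apply: eq_big => [u|u /andP[uNs _]]; last exact: Ho.
  by case: (boolP (u \in s)) => //= uNs; rewrite gg'.
have [Us _ _ _] := gP.
rewrite !(sum_seq_split x0 _ Us); congr (_ + _); last first.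
  by apply: eq_bigr => v vNs; rewrite Ho.
rewrite [LHS](reindex_inj rev_ord_inj) /=; apply: eq_bigr => i _.
by rewrite Hp; [congr (W l (p _)); have := ltn_ord i; lia | have := ltn_ord i; lia].
Qed.

Hypothesis g_total : forall u, exists v, g u v.
Hypotheses (a_ex : exists2 v, v \notin s & a v) (b_ex : exists2 v, v \notin s & b v).

(** The mirrored half is needed for (3): a vertex of B trades [p_k] for [p_0], which calls for
    W(p_k) <= W'(p_0). *)
Lemma slide_walks_dominates (l : nat) :
  [/\ dominates k (fun i => W l (p i)) (fun i => W' l (p i))
        (sum_off s a (W l)) (sum_off s a (W' l)) (sum_off s b (W' l)),
      dominates k (fun i => W l (p (k - i))) (fun i => W' l (p i))
        (sum_off s b (W l)) (sum_off s b (W' l)) (sum_off s a (W' l)) &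
      forall v, v \notin s -> W l v <= W' l v].
Proof.
have [va vaNs ava] := a_ex; have [vb vbNs bvb] := b_ex.
elim: l => [|l [Ha Hb Ho]].
  by split=> //; split=> // j _ _; rewrite -addnA leq_add2l leq_addl.
have Hon v : v \notin s -> W l.+1 v <= W' l.+1 v.
  move=> vNs /=; rewrite (sum_neighbors_off gP) // (sum_neighbors_off g'P) //=.
  have leo : sum_off s (g v) (W l) <= sum_off s (g' v) (W' l).
    rewrite /sum_off (eq_bigl (fun u => (u \notin s) && g' v u)).
      by apply: leq_sum => u /andP[uNs _]; exact: Ho.
    by move=> u; case: (boolP (u \in s)) => //= uNs; rewrite gg'.
  have := Ha.1 0 0 isT; have := Hb.1 0 0 isT; rewrite subn0.
  have := abP vNs; case: (a v); case: (b v) => //=; lia.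
have leS c : sum_off s c (W l) <= sum_off s c (W' l) by apply: leq_sum_off.
(* Monotonicity in the length is applied in [g], then (3) at length l + 1 passes to [g']. *)
have leSn c : sum_off s c (W l) <= sum_off s c (W' l.+1).
  by apply: leq_sum_off => v vNs; apply: leq_trans (Hon v vNs); exact: leq_walks_from.
have leS2 c : sum_off s c (fun v => sum_off s (g v) (W l)) <=
    sum_off s c (fun v => sum_off s (g' v) (W' l)).
  apply: leq_sum_off => v vNs.
  rewrite /sum_off (eq_bigl (fun u => (u \notin s) && g' v u)).
    by apply: leq_sum => u /andP[uNs _]; exact: Ho.
  by move=> u; case: (boolP (u \in s)) => //= uNs; rewrite gg'.
have st := attached_path_step l gP s2.
have st' := attached_path_step l g'P s2.
rewrite sum_off_predU (sum_off0 (a := pred0)) // in st'.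
split=> //.
  apply: (dominates_step k0 (sum_off_gt0 vaNs ava) (sum_off_gt0 vbNs bvb) st st'
    (leS a) (leS b) (leSn b) (leS2 a) _ _ _ Ha).
  - apply: (sum_off_walks_from (t := false) l gP s2) => v vNs av.
    by have := abP vNs; rewrite av => /negPf.
  - by apply: (sum_off_walks_from (t := false) l g'P s2) => v vNs av /=; rewrite av.
  - by apply: (sum_off_walks_from (t := false) l g'P s2) => v vNs bv /=; rewrite bv orbT.
(* In [g'] both sets hang at [p_0], so exchanging them only reorders a sum; the path is reversed in
   [g] alone. *)
rewrite addnC in st'.
apply: (dominates_step k0 (sum_off_gt0 vbNs bvb) (sum_off_gt0 vaNs ava)
  (path_step_rev k0 st) st' (leS b) (leS a) (leSn a) (leS2 b) _ _ _ Hb).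
- rewrite subn0; apply: (sum_off_walks_from (t := true) l gP s2) => v vNs bv.
  by have := abP vNs; rewrite bv andbT => /negPf.
- by apply: (sum_off_walks_from (t := false) l g'P s2) => v vNs bv /=; rewrite bv orbT.
- by apply: (sum_off_walks_from (t := false) l g'P s2) => v vNs av /=; rewrite av.
Qed.

Lemma slide_walks_leq (l : nat) : \sum_v W l v <= \sum_v W' l v.
Proof.
have [[Hp _] _ Ho] := slide_walks_dominates l; have [Us _ _ _] := gP.
rewrite !(sum_seq_split x0 _ Us); apply: leq_add; last exact: leq_sum.
(* Doubling pairs each index with its reflection and leaves no middle index to treat apart. *)
have sum2 (F : nat -> nat) :
    (\sum_(i < size s) F i).*2 = \sum_(i < size s) (F i + F (size s - i.+1)).
  by rewrite -addnn {2}(reindex_inj rev_ord_inj) big_split.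
rewrite -leq_double (sum2 (fun i => W l (p i))) (sum2 (fun i => W' l (p i))).
apply: leq_sum => i _.
by apply: Hp; have := ltn_ord i; lia.
Qed.

End Slide.

(** * Paths in trees and the KC-transform *)

Section TreePath.

Variables (V : finType) (e : rel V) (x y : V) (q : seq V).
Hypotheses (eT : is_tree e) (xqy : path e x (rcons q y))
  (Us : uniq (x :: rcons q y)) (deg2 : forall v, v \in q -> deg e v = 2).

Local Notation s := (x :: rcons q y).
Local Notation p := (nth x s).
Local Notation k := (size q).+1.

Lemma size_tree_path : size s = k.+1. Proof. by rewrite /= size_rcons. Qed.

Let esym : symmetric e. Proof. by case: eT => [[]]. Qed.

Lemma nth_tree_path_last : p k = y.
Proof. by rewrite /= nth_rcons ltnn eqxx. Qed.

Lemma nth_tree_path_penult : p (size q) = last x q.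
Proof. by rewrite -nth_last -rcons_cons nth_rcons /= ltnS leqnn; case: q. Qed.

Lemma tree_path_edge (i : nat) : i < k -> e (p i) (p i.+1).
Proof. by move=> ik; apply: (pathP x xqy); rewrite size_rcons. Qed.

Lemma nth_tree_path_inj (i j : nat) : i <= k -> j <= k -> (p i == p j) = (i == j).
Proof. by move=> ik jk; rewrite nth_uniq ?size_tree_path. Qed.

(** The two path neighbours are distinct and already fill a neighbourhood of size two. *)
Lemma tree_path_interior (i : nat) (v : V) : 0 < i -> i < k ->
  e (p i) v -> (v == p i.-1) || (v == p i.+1).
Proof.
case: i => // i _ ik eiv.
have iq : p i.+1 \in q by rewrite /= nth_rcons (_ : i < size q) // mem_nth.
have sub : [set p i; p i.+2] \subset nbhd e (p i.+1).
  apply/subsetP => u; rewrite !inE => /orP[]/eqP->; last exact: tree_path_edge.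
  by rewrite esym tree_path_edge // ltnW.
have /eqP E : [set p i; p i.+2] == nbhd e (p i.+1).
  rewrite eqEcard sub -/(deg e _) deg2 // cards2 nth_tree_path_inj //; lia.
have : v \in nbhd e (p i.+1) by rewrite inE.
by rewrite -E !inE.
Qed.

(** If there are interior vertices, the edge would close the path into a cycle. *)
Lemma tree_path_chord : e x y = (size q == 0).
Proof.
have [q0|q0] := posnP (size q).
  by move: xqy; rewrite (size0nil q0) /= andbT => ->.
apply/negP => exy; case: eT => _ _ /(_ s Us); rewrite size_tree_path => /(_ _)/negP[] //.
by rewrite /= rcons_path xqy last_rcons esym.
Qed.

(** Edges at an interior vertex are settled by its degree; what remains is the edge between the two
    ends, decided by [tree_path_chord]. *)
Lemma tree_path_adj (i j : nat) : i <= k -> j <= k ->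
  e (p i) (p j) = (j == i.+1) || (i == j.+1).
Proof.
move=> ik jk; apply/idP/orP; last first.
  by case=> /eqP h; [|rewrite esym]; rewrite h tree_path_edge //; lia.
have inner i' j' : i' <= k -> j' <= k -> 0 < i' -> i' < k ->
    e (p i') (p j') -> j' = i'.+1 \/ i' = j'.+1.
  move=> i'k j'k i'0 lt_i'k /(tree_path_interior i'0 lt_i'k).
  by rewrite !nth_tree_path_inj //; lia.
have eirr : irreflexive e by case: eT => [[]].
move=> eij.
have [/andP[i0 lt_ik]|ni] := boolP ((0 < i) && (i < k)).
  by have := inner i j ik jk i0 lt_ik eij; lia.
have [/andP[j0 lt_jk]|nj] := boolP ((0 < j) && (j < k)).
  by have := inner j i jk ik j0 lt_jk; rewrite esym => /(_ eij); lia.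
have [hi|hi] : i = 0 \/ i = k by lia.
  have [hj|hj] : j = 0 \/ j = k by lia.
    by move: eij; rewrite hi hj eirr.
  by move: eij; rewrite hi hj nth_tree_path_last tree_path_chord; lia.
have [hj|hj] : j = 0 \/ j = k by lia.
  by move: eij; rewrite hi hj nth_tree_path_last esym tree_path_chord; lia.
by move: eij; rewrite hi hj eirr.
Qed.

Lemma tree_attached_path : attached_path e x s (e x) (e y).
Proof.
split=> // [i j|v i vNs]; rewrite size_tree_path !ltnS.
  exact: tree_path_adj.
move=> ik; have [->|i0] := posnP i; first by rewrite /= orbF esym.
have [->|] := eqVneq i k; first by rewrite nth_tree_path_last eqxx esym.
rewrite eqSS => /negPf ik'; rewrite ik' /=.
apply/negP => evi; have lt_ik : i < k by lia.
move: vNs; rewrite esym in evi.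
by case/orP: (tree_path_interior i0 lt_ik evi) => /eqP->;
  rewrite mem_nth ?size_tree_path //; lia.
Qed.

(** A common neighbour off the path would close it into a cycle. *)
Lemma tree_path_ends_disjoint (v : V) : v \notin s -> ~~ (e x v && e y v).
Proof.
move=> vNs; apply/negP => /andP[exv eyv].
case: eT => _ _ /(_ (v :: s)); rewrite cons_uniq vNs Us => /(_ isT).
rewrite /= size_rcons => /(_ isT)/negP[].
by rewrite rcons_path -/(rcons s v) /= xqy last_rcons eyv esym exv.
Qed.

Local Notation e' := (KC e x y (last x q)).

(** The path is induced, so [last x q] is the only neighbour of [y] on it. *)
Lemma KC_moved (v : V) : (v \in nbhd e y :\ last x q) = (v \notin s) && e y v.
Proof.
rewrite in_setD1 inE -nth_tree_path_penult.
have [/(nthP x)[i]|vNs] := boolP (v \in s).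
  rewrite size_tree_path ltnS => ik <-.
  rewrite nth_tree_path_inj //.
  have -> : e y (p i) = e (p k) (p i) by rewrite nth_tree_path_last.
  rewrite tree_path_adj //; lia.
case: eqP => // h.
by rewrite h mem_nth ?size_tree_path in vNs; lia.
Qed.

Lemma KC_attached_path : attached_path e' x s (predU (e x) (e y)) pred0.
Proof.
case: tree_attached_path => _ epp _ eop.
have KCE u v : e' u v =
    (e u v && ~~ (((u == y) && ((v \notin s) && e y v)) ||
                  ((v == y) && ((u \notin s) && e y u)))) ||
    (((u == x) && ((v \notin s) && e y v)) || ((v == x) && ((u \notin s) && e y u))).
  by rewrite /KC !KC_moved.
split=> // [i j lt_i lt_j|u v|v i vNs lt_i].
(* Every moved edge has an end off the path, so adjacency within [s] is unchanged. *)
- by rewrite KCE !mem_nth // -[~~ true]/false !andFb !andbF !orbF andbT epp.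
- rewrite !KCE; rewrite (esym u v).
  by congr orb; [congr (_ && ~~ _)|]; exact: orbC.
- rewrite KCE eop // vNs mem_nth //=.
  move: lt_i; rewrite size_tree_path ltnS => ik.
  have vE j : j <= k -> (v == p j) = false.
    move=> jk; apply/negP => /eqP h; move: vNs; rewrite h mem_nth //.
    by rewrite size_tree_path.
  have -> : (v == y) = false by have := vE k (leqnn k); rewrite nth_tree_path_last.
  have -> : (v == x) = false by rewrite (vE 0).
  have -> : (p i == y) = (i == k).
    by rewrite -(@nth_tree_path_inj i k) // nth_tree_path_last.
  have -> : (p i == x) = (i == 0) by rewrite (nth_tree_path_inj (j := 0)).
  rewrite /= !andbF orbF /= size_rcons eqSS.
  by case: (e x v); case: (e y v); case: eqP => [->|_] //=; case: eqP.
Qed.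

End TreePath.

(* x :: rcons q y is the (unique) x–y path P in T, with x <> y; q lists the
   interior vertices, which all have degree 2; z = last x q is the neighbour
   of y on P. *)
Theorem theorem2 (V : finType) (e : rel V) (x y : V) (q : seq V) :
  is_tree e ->
  path e x (rcons q y) ->
  uniq (x :: rcons q y) ->
  (forall v, v \in q -> deg e v = 2) ->
  forall l : nat, 1 <= l ->
    num_walks e l <= num_walks (KC e x y (last x q)) l.
Proof.
move=> eT xqy Us deg2 l _; rewrite !num_walksE.
set s := x :: rcons q y.
have moved := KC_moved eT xqy Us deg2.
have KC_off u v : u \notin s -> v \notin s -> e u v = KC e x y (last x q) u v.
  have [xs ys] : x \in s /\ y \in s by rewrite mem_head inE mem_rcons mem_head orbT.
  move=> us vs; rewrite /KC.
  have -> : (u == y) = false by apply: contraNF us => /eqP->.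
  have -> : (v == y) = false by apply: contraNF vs => /eqP->.
  have -> : (u == x) = false by apply: contraNF us => /eqP->.
  have -> : (v == x) = false by apply: contraNF vs => /eqP->.
  by rewrite andbT orbF.
have eP := tree_attached_path eT xqy Us deg2.
have e'P := KC_attached_path eT xqy Us deg2.
have disj := tree_path_ends_disjoint eT xqy Us.
have s2 : 1 < size s by rewrite /= size_rcons.
have [/existsP[b /andP[bNs eyb]]|noB] := boolP [exists v, (v \notin s) && e y v]; last first.
  apply: leq_sum => v _; rewrite (eq_walks_from (e' := KC e x y (last x q))) // => u w.
  have N0 t : (t \in nbhd e y :\ last x q) = false.
    by rewrite moved; apply: contraNF noB => ?; apply/existsP; exists t.
  by rewrite /KC !N0 !andbF !orbF andbT.
have [/existsP[a /andP[aNs exa]]|noA] := boolP [exists v, (v \notin s) && e x v]; last first.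
  rewrite (slide_walks_iso eP e'P) // => v vNs; apply: contra noA => exv.
  by apply/existsP; exists v; rewrite vNs.
apply: (slide_walks_leq eP e'P) => // [u||]; [|by exists a|by exists b].
(* No vertex is isolated: [x] has the neighbour [a], and any other vertex starts a path to [x]. *)
have [->|ux] := eqVneq u x; first by exists a.
case: eT => _ /(_ u x)/connectP[[/= _ xu|w r /= /andP[euw _] _]] _; last by exists w.
by rewrite xu eqxx in ux.
Qed.
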